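(* Let $p>3$ be a prime and $m,n\in R_p$ with $m\not\equiv 0\pmod p$. Then $$\sum_{x=0}^{p-1}\left(\frac{x^3+mx+n}{p}\right)\equiv \begin{cases} -(-3m)^{\frac{p-1}{4}}\,P_{[p/6]}\!\left(\dfrac{3n\sqrt{-3m}}{2m^2}\right)\pmod p & \text{if } p\equiv 1\pmod 4,\\[2mm] -\dfrac{(-3m)^{\frac{p+1}{4}}}{\sqrt{-3m}}\,P_{[p/6]}\!\left(\dfrac{3n\sqrt{-3m}}{2m^2}\right)\pmod p & \text{if } p\equiv 3\pmod 4.\end{cases}$$
   Context: $R_p$ is the ring of rational numbers whose denominator is coprime to $p$; congruences modulo $p$ are in $R_p$ (i.e. $a\equiv b\pmod p$ means $(a-b)/p\in R_p$). $\left(\frac{a}{p}\right)$ is the Legendre symbol, extended to $a\in R_p$ via the residue class of $a$ modulo $p$ (and equal to $0$ if $a\equiv 0 \pmod p$). $[x]$ is the greatest integer not exceeding $x$. $P_n(x)$ is the $n$-th Legendre polynomial: $P_0(x)=1$, $P_1(x)=x$, $(n+1)P_{n+1}(x)=(2n+1)xP_n(x)-nP_{n-1}(x)$ for $n\ge 1$; one has $P_n(-x)=(-1)^nP_n(x)$. $\sqrt{-3m}$ denotes a fixed (complex) square root of $-3m$, the same in each occurrence; since $[p/6]$ is even for $p\equiv 1\pmod 4$ and odd for $p\equiv 3\pmod 4$, the right-hand sides lie in $R_p$ and do not depend on the choice of root. *)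

(* Defs.v *)
From HB Require Import structures.
From mathcomp Require Import all_boot all_order all_algebra all_field.

Set Implicit Arguments.
Unset Strict Implicit.
Unset Printing Implicit Defensive.

Import Order.TTheory GRing.Theory Num.Theory.

Local Open Scope ring_scope.

Definition Rp (p : nat) : {pred rat} := fun r => coprime `|denq r|%N p.

Definition eqRp (p : nat) (a b : rat) : bool := (a - b) / p%:R \in Rp p.

(* Congruence modulo p between a rational and a complex number: the latter is
   required to be (the image of) an element of R_p. *)
Definition eqRpC (p : nat) (a : rat) (z : algC) : Prop :=
  exists b : rat, [/\ b \in Rp p, z = ratr b & eqRp p a b].

(* For p prime and a in R_p, the residue class of a modulo p is the element
   (numq a)%:~R / (denq a)%:~R of 'F_p, i.e. ratr a. *)
Definition legendre_symbol (p : nat) (a : rat) : int :=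
  let c : 'F_p := ratr a in
  if c == 0 then 0 else if [exists y : 'F_p, y ^+ 2 == c] then 1 else -1.

Fixpoint LegendreP (F : numFieldType) (n : nat) : {poly F} :=
  match n with
  | 0%N => 1
  | k.+1 =>
    match k with
    | 0%N => 'X
    | j.+1 =>
      k.+1%:R^-1 *:
        ((2 * k + 1)%:R *: ('X * LegendreP F k) - k%:R *: LegendreP F j)
    end
  end.

Lemma LegendreP_rec (F : numFieldType) (n : nat) (x : F) : (1 <= n)%N ->
  n.+1%:R * (LegendreP F n.+1).[x] =
    (2 * n + 1)%:R * x * (LegendreP F n).[x] - n%:R * (LegendreP F n.-1).[x].
Proof.
case: n => // n _.
have -> : LegendreP F n.+2 = n.+2%:R^-1 *:
   ((2 * n.+1 + 1)%:R *: ('X * LegendreP F n.+1) - n.+1%:R *: LegendreP F n).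
  by [].
rewrite hornerZ mulrA divff ?pnatr_eq0 // mul1r.
by rewrite hornerD hornerN !hornerZ hornerM hornerX mulrA.
Qed.

(* Main.v *)
Require Import Defs.
From HB Require Import structures.
From mathcomp Require Import all_boot all_order all_algebra all_field.
From mathcomp Require Import cyclic ring zify.

Set Implicit Arguments.
Unset Strict Implicit.
Unset Printing Implicit Defensive.

Import Order.TTheory GRing.Theory Num.Theory.

Local Open Scope ring_scope.

(** Write [p = 2q + 1] and [N = p %/ 6]. Both cases of the theorem say that
    [S = - s^q P_N(3ns / 2m^2)] modulo [p], since [s^2 = -3m].

    By Euler's criterion [S] is the sum over [x] in [F_p] of
    [(x^3 + mx + n)^q]. Expanding by the binomial theorem and summing powers of
    [x], of which only [x^(2q)] contributes, gives
      [S = - \sum_e A_e m^((q-3e)/2) n^e],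
    with [A_e = q! / (e! ((q+e)/2)! ((q-3e)/2)!)] and [e] running over the
    integers of the parity of [q] (lemma [sum_cubic_expf]). On the family
    [m = -3], [n = 2t] this is minus the polynomial in [t] with coefficients
    [a_e = A_e (-3)^((q-3e)/2) 2^e], and comparing exponents shows that for
    general [m], [n] it is enough to prove [a_e = 3^q b_e], where [b_e] is
    the reduction of the coefficient of degree [e] of [P_N].

    Now [q] is -1/2 in [F_p], and [N] is -1/6 or -5/6, so that
    [N(N+1) = -5/36]. The multinomial ratio [A_(e+2) / A_e]
    ([cubic_coef_recF]) and Legendre's differential equation
    ([LegendreP_coef_rec]) thus turn into the same recurrence
      [36 (e+1)(e+2) u_(e+2) = (6e+1)(6e+5) u_e].
    As both sequences live on one parity class, they are proportional
    ([parity_rec_unique]). The factor is found at [t = 1]: there [P_N] is 1, while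
    the cubic is [x^3 - 3x + 2 = (x-1)^2 (x+2)], whose power sum is elementary
    ([sum_cubic_node]). *)

(** * Reduction of rationals modulo a prime *)

Lemma natr_Fp_neq0 (p k : nat) : prime p -> (0 < k < p)%N -> k%:R != 0 :> 'F_p.
Proof.
move=> p_prime /andP[k_gt0 k_lt].
by rewrite -(dvdn_pcharf (pchar_Fp p_prime)) gtnNdvd.
Qed.

(** The map [ratr] into ['F_p] is not a ring morphism on all of [rat]; this
    relation is its restriction to [R_p], where it is one. Stating results as
    relations makes membership in [R_p] and the value of the residue class
    follow from the same rules. *)
Definition reduces (p : nat) (a : rat) (c : 'F_p) : Prop :=
  a \in Rp p /\ ratr a = c.

Lemma intr_Fp_eq0 (p : nat) (z : int) : prime p ->
  (z%:~R == 0 :> 'F_p) = (p %| `|z|)%N.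
Proof.
move=> p_prime; rewrite (dvdn_pcharf (pchar_Fp p_prime)).
by case: z => n //; rewrite NegzE rmorphN oppr_eq0.
Qed.

Lemma in_RpE (p : nat) (a : rat) : prime p ->
  (a \in Rp p) = ((denq a)%:~R != 0 :> 'F_p).
Proof.
move=> p_prime.
by rewrite intr_Fp_eq0 // -prime_coprime // coprime_sym.
Qed.

(** The residue class may be computed from any fraction whose denominator is
    prime to [p], reduced or not; all the compatibilities below rest on this. *)
Lemma reduces_frac (p : nat) (a b : int) : prime p -> b%:~R != 0 :> 'F_p ->
  reduces (a%:~R / b%:~R) (a%:~R / b%:~R : 'F_p).
Proof.
move=> p_prime b_neq0; set r : rat := a%:~R / b%:~R.
have bZ : b != 0 by apply: contraNneq b_neq0 => ->.
have cross : a * denq r = numq r * b.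
  apply: (@intr_inj rat); rewrite !intrM.
  have dn : (denq r)%:~R != 0 :> rat by rewrite intr_eq0 denq_eq0.
  have bQ : b%:~R != 0 :> rat by rewrite intr_eq0.
  have : (numq r)%:~R / (denq r)%:~R = a%:~R / b%:~R :> rat by rewrite divq_num_den.
  by move/eqP; rewrite eqr_div // => /eqP ->.
have crossF : a%:~R * (denq r)%:~R = (numq r)%:~R * b%:~R :> 'F_p.
  by rewrite -!intrM cross.
have d_neq0 : (denq r)%:~R != 0 :> 'F_p.
  apply/eqP => d0; move: crossF; rewrite d0 mulr0 => /esym/eqP.
  rewrite mulf_eq0 (negPf b_neq0) orbF => n0.
  have /eqP := coprime_num_den r.
  have : (p %| gcdn `|numq r| `|denq r|)%N.
    by rewrite dvdn_gcd -!intr_Fp_eq0 // n0 d0 eqxx.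
  by move=> /[swap] ->; rewrite dvdn1 => /eqP p1; rewrite p1 in p_prime.
split; first by rewrite in_RpE.
by rewrite /ratr; apply/eqP; rewrite eqr_div // crossF.
Qed.

Lemma reduces_Rp (p : nat) (a : rat) : a \in Rp p -> reduces a (ratr a : 'F_p).
Proof. by []. Qed.

Lemma reduces_inj (p : nat) (a : rat) (c d : 'F_p) :
  reduces a c -> reduces a d -> c = d.
Proof. by move=> [_ <-] []. Qed.

Lemma reducesP (p : nat) (a : rat) (c : 'F_p) : prime p -> reduces a c ->
  exists n d : int,
    [/\ d%:~R != 0 :> 'F_p, a = n%:~R / d%:~R & c = n%:~R / d%:~R].
Proof.
move=> p_prime [aRp <-]; exists (numq a), (denq a).
by rewrite -in_RpE // divq_num_den.
Qed.

Lemma reduces_int (p : nat) (z : int) : prime p ->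
  reduces z%:~R (z%:~R : 'F_p).
Proof.
move=> p_prime; have := @reduces_frac p z 1 p_prime.
by rewrite !divr1; apply; rewrite oner_eq0.
Qed.

Lemma reduces_nat (p : nat) (k : nat) : prime p -> reduces k%:R (k%:R : 'F_p).
Proof. exact: (@reduces_int p k). Qed.

Lemma intr_Fp_neq0 (p : nat) (z : int) : z%:~R != 0 :> 'F_p -> z%:~R != 0 :> rat.
Proof. by rewrite intr_eq0; apply: contraNneq => ->. Qed.

Lemma reducesD (p : nat) (a b : rat) (c d : 'F_p) : prime p ->
  reduces a c -> reduces b d -> reduces (a + b) (c + d).
Proof.
move=> p_prime /(reducesP p_prime)[x [y [y0 -> ->]]].
move=> /(reducesP p_prime)[z [t [t0 -> ->]]].
have [yQ tQ] := (intr_Fp_neq0 y0, intr_Fp_neq0 t0).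
rewrite !addf_div //.
rewrite -!intrM -!intrD; apply: reduces_frac => //.
by rewrite intrM mulf_neq0.
Qed.

Lemma reducesN (p : nat) (a : rat) (c : 'F_p) : prime p ->
  reduces a c -> reduces (- a) (- c).
Proof.
move=> p_prime /(reducesP p_prime)[x [y [y0 -> ->]]].
by rewrite -!mulNr -!intrN; apply: reduces_frac.
Qed.

Lemma reducesM (p : nat) (a b : rat) (c d : 'F_p) : prime p ->
  reduces a c -> reduces b d -> reduces (a * b) (c * d).
Proof.
move=> p_prime /(reducesP p_prime)[x [y [y0 -> ->]]].
move=> /(reducesP p_prime)[z [t [t0 -> ->]]].
rewrite !mulf_div -!intrM; apply: reduces_frac => //.
by rewrite intrM mulf_neq0.
Qed.

Lemma reducesV (p : nat) (a : rat) (c : 'F_p) : prime p -> c != 0 ->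
  reduces a c -> reduces a^-1 c^-1.
Proof.
move=> p_prime c_neq0 /(reducesP p_prime)[x [y [y0 -> cE]]].
rewrite cE !invf_div; apply: reduces_frac => //.
by apply: contraNneq c_neq0 => x0; rewrite cE x0 mul0r.
Qed.

Lemma reducesX (p : nat) (a : rat) (c : 'F_p) (k : nat) : prime p ->
  reduces a c -> reduces (a ^+ k) (c ^+ k).
Proof.
move=> p_prime ac; elim: k => [|k IHk]; first exact: (reduces_nat 1).
by rewrite !exprS; apply: reducesM.
Qed.

Lemma reduces_sum (p : nat) (I : Type) (r : seq I) (P : pred I)
    (f : I -> rat) (g : I -> 'F_p) : prime p ->
  (forall i, P i -> reduces (f i) (g i)) ->
  reduces (\sum_(i <- r | P i) f i) (\sum_(i <- r | P i) g i).
Proof.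
move=> p_prime fg; elim/big_rec2: _ => [|i x y Pi]; first exact: (reduces_nat 0).
by apply: reducesD => //; apply: fg.
Qed.

Lemma reduces_eqRp (p : nat) (a b : rat) (c : 'F_p) : prime p ->
  reduces a c -> reduces b c -> eqRp p a b.
Proof.
move=> p_prime ac bc.
have [x [y [y0 abE cE]]] := reducesP p_prime (reducesD p_prime ac (reducesN p_prime bc)).
rewrite /eqRp abE.
have : (p %| `|x|)%N.
  by rewrite -intr_Fp_eq0 //; move/esym/eqP: cE; rewrite subrr mulf_eq0 invr_eq0 (negPf y0) orbF.
case/dvdnP=> k xE.
have -> : x = (sgz x * k) * p.
  by rewrite -mulrA -PoszM -xE -intEsg.
rewrite intrM mulrAC mulfK ?pnatr_eq0 -?lt0n ?prime_gt0 //.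
by have [] := @reduces_frac p (sgz x * k) y p_prime y0.
Qed.

Lemma eqRp0 (p : nat) (a : rat) : prime p -> a \in Rp p ->
  ratr a = 0 :> 'F_p -> eqRp p a 0.
Proof.
move=> p_prime aRp a0; apply: (@reduces_eqRp p _ _ 0) => //.
exact: (reduces_nat 0).
Qed.

(** * Coefficients of Legendre polynomials *)

Lemma LegendreP_recX (F : numFieldType) (n : nat) :
  n.+2%:R *: LegendreP F n.+2 =
    (2 * n.+1 + 1)%:R *: ('X * LegendreP F n.+1) - n.+1%:R *: LegendreP F n.
Proof.
have -> : LegendreP F n.+2 = n.+2%:R^-1 *:
   ((2 * n.+1 + 1)%:R *: ('X * LegendreP F n.+1) - n.+1%:R *: LegendreP F n).
  by [].
by rewrite scalerA divff ?pnatr_eq0 // scale1r.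
Qed.

Lemma LegendreP_ind (Q : nat -> Prop) :
  Q 0%N -> Q 1%N -> (forall n, Q n -> Q n.+1 -> Q n.+2) -> forall n, Q n.
Proof.
move=> Q0 Q1 QS n; suff [] : Q n /\ Q n.+1 by [].
by elim: n => [|n [Qn QSn]]; split=> //; apply: QS.
Qed.

Lemma map_LegendreP (F : numFieldType) (n : nat) :
  map_poly ratr (LegendreP rat n) = LegendreP F n.
Proof.
elim/LegendreP_ind: n => [||n IH0 IH1]; [exact: rmorph1|exact: map_polyX|].
apply: (@scalerI _ _ n.+2%:R); first by rewrite pnatr_eq0.
rewrite LegendreP_recX -IH0 -IH1.
have <- (k : nat) : ratr k%:R = k%:R :> F by exact: ratr_nat.
rewrite -map_polyZ LegendreP_recX rmorphB /= !map_polyZ rmorphM /= map_polyX.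
by rewrite !ratr_nat.
Qed.

Lemma size_LegendreP (F : numFieldType) (n : nat) :
  (size (LegendreP F n) <= n.+1)%N.
Proof.
elim/LegendreP_ind: n => [||n IH0 IH1]; rewrite ?size_poly1 ?size_polyX //.
rewrite (leq_trans (size_scale_leq _ _)) //.
rewrite (leq_trans (size_polyD _ _)) // geq_max size_polyN.
rewrite !(leq_trans (size_scale_leq _ _)) //; first by rewrite ltnW // ltnW.
by rewrite (leq_trans (size_polyMleq _ _)) // size_polyX.
Qed.

Lemma LegendreP_parity (F : numFieldType) (n e : nat) :
  odd (n + e) -> (LegendreP F n)`_e = 0.
Proof.
elim/LegendreP_ind: n e => [||n IH0 IH1] e odd_ne.
- by rewrite coef1; case: e odd_ne.
- by rewrite coefX; case: e odd_ne => [|[|[]]].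
have en : odd (n + e) by move: odd_ne; rewrite !addSn /= negbK.
apply: (@mulfI _ n.+2%:R); first by rewrite pnatr_eq0.
rewrite -coefZ LegendreP_recX coefB !coefZ coefXM IH0 // mulr0 subr0 mulr0.
case: e {odd_ne} en => [|e] en; rewrite ?mulr0 //.
by rewrite [_ == _]/= IH1 ?mulr0 // addSnnS.
Qed.

Lemma LegendreP_at1 (F : numFieldType) (n : nat) : (LegendreP F n).[1] = 1.
Proof.
elim/LegendreP_ind: n => [||n IH0 IH1]; rewrite ?hornerC ?hornerX //.
apply: (@mulfI _ n.+2%:R); first by rewrite pnatr_eq0.
rewrite -hornerZ LegendreP_recX hornerD hornerN !hornerZ hornerM hornerX IH0 IH1.
rewrite natrD natrM; ring.
Qed.

(** The two classical derivative identities are proved together: each step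
    from [n] to [n+1] of the first one uses the second. They serve only to
    obtain Legendre's differential equation. *)
Lemma LegendreP_deriv (F : numFieldType) (n : nat) :
  (LegendreP F n.+1)^`() = 'X * (LegendreP F n)^`() + n.+1%:R *: LegendreP F n
  /\ 'X * (LegendreP F n.+1)^`() - (LegendreP F n)^`()
     = n.+1%:R *: LegendreP F n.+1.
Proof.
elim: n => [|n [IHa IHb]].
  by rewrite /= derivX derivC; split; rewrite ?mulr0 ?mulr1 ?add0r ?subr0 ?scale1r.
have A : (LegendreP F n.+2)^`() =
    'X * (LegendreP F n.+1)^`() + n.+2%:R *: LegendreP F n.+1.
  apply: (@scalerI _ _ n.+2%:R); first by rewrite pnatr_eq0.
  rewrite -derivZ LegendreP_recX derivB !derivZ derivM derivX.
  move: IHb; set P0 := LegendreP F n; set P1 := LegendreP F n.+1.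
  rewrite -!mul_polyC !rmorph_nat => IHb.
  have -> : P0^`() = 'X * P1^`() - n.+1%:R * P1 by rewrite -IHb; ring.
  rewrite natrD natrM; ring.
split=> //; rewrite A.
have -> : (LegendreP F n.+1)^`() = 'X * (LegendreP F n)^`() + n.+1%:R *: LegendreP F n by [].
rewrite LegendreP_recX.
have H : 'X * ('X * (LegendreP F n)^`() + n.+1%:R *: LegendreP F n)
    - (LegendreP F n)^`() = n.+1%:R *: LegendreP F n.+1 by rewrite -IHa.
move: H; set P0 := LegendreP F n; set P1 := LegendreP F n.+1.
rewrite -!mul_polyC !rmorph_nat => H.
have -> : 'X * ('X * ('X * P0^`() + n.+1%:R * P0) + n.+2%:R * P1) -
  ('X * P0^`() + n.+1%:R * P0) =
  'X * ('X * ('X * P0^`() + n.+1%:R * P0) - P0^`()) + n.+2%:R * ('X * P1) - n.+1%:R * P0 by ring.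
rewrite H natrD natrM; ring.
Qed.

(** The identities of [LegendreP_deriv] combine into
    [(X^2 - 1) P_n' = n (X P_n - P_(n-1))], and differentiating once more
    eliminates [P_(n-1)]. *)
Lemma LegendreP_ode (F : numFieldType) (n : nat) :
  (('X ^+ 2 - 1) * (LegendreP F n)^`())^`() = (n * n.+1)%:R *: LegendreP F n.
Proof.
case: n => [|n]; first by rewrite /= derivC mulr0 deriv0 scale0r.
have [A B] := LegendreP_deriv F n.
have -> : ('X ^+ 2 - 1) * (LegendreP F n.+1)^`() =
   n.+1%:R *: ('X * LegendreP F n.+1 - LegendreP F n).
  have -> : ('X ^+ 2 - 1) * (LegendreP F n.+1)^`() =
    'X * ('X * (LegendreP F n.+1)^`() - (LegendreP F n)^`())
     - ((LegendreP F n.+1)^`() - 'X * (LegendreP F n)^`()) by ring.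
  by rewrite B A [X in _ - (X - _)]addrC addrK scalerBr scalerAr.
rewrite derivZ derivB derivM derivX natrM -scalerA; congr (_ *: _).
by rewrite mul1r -addrA B -[n.+2%:R]nat1r scalerDl scale1r.
Qed.

Lemma LegendreP_coef_rec (F : numFieldType) (n e : nat) :
  (e.+1 * e.+2)%:R * (LegendreP F n)`_e.+2 =
    ((e * e.+1)%:R - (n * n.+1)%:R) * (LegendreP F n)`_e.
Proof.
have := congr1 (fun P : {poly F} => P`_e) (LegendreP_ode F n).
rewrite coefZ coef_deriv mulrBl mul1r coefB coef_deriv coefXnM.
case: e => [|e] /=.
  by rewrite sub0r mul0n sub0r mulNr => <-; rewrite mul1n mulr_natl; ring.
rewrite coef_deriv !subSS subn0 !mulrnBl => H.
rewrite mulrBl -H; set a := _`_e.+1; set b := _`_e.+3.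
ring.
Qed.

Lemma sum_LegendreP_coefs (F : numFieldType) (N q : nat) (t : F) : (N <= q)%N ->
  (LegendreP F N).[t] = \sum_(e < q.+1) (LegendreP F N)`_e * t ^+ e.
Proof.
move=> N_le; apply: horner_coef_wide.
exact: leq_trans (size_LegendreP F N) _.
Qed.

(** The recurrence defining [P_n] divides only by integers up to [n], which
    are invertible modulo [p]. *)
Lemma LegendreP_coef_Rp (p n e : nat) : prime p -> (n < p)%N ->
  (LegendreP rat n)`_e \in Rp p.
Proof.
move=> p_prime; suff H : (n < p)%N -> exists c : 'F_p, reduces (LegendreP rat n)`_e c.
  by move=> n_lt; have [c []] := H n_lt.
elim/LegendreP_ind: n e => [e|e|n IH0 IH1 e] n_lt.
- by exists (e == 0%N)%:R; rewrite coef1; apply: reduces_nat.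
- by exists (e == 1%N)%:R; rewrite coefX; apply: reduces_nat.
have [c0 r0] := IH0 e (ltnW (ltnW n_lt)).
have [c1 r1] : exists c : 'F_p, reduces ('X * LegendreP rat n.+1)`_e c.
  rewrite coefXM; case: eqP => _; last exact: IH1 (ltnW n_lt).
  by exists 0; apply: (reduces_nat 0).
exists (n.+2%:R^-1 * ((2 * n.+1 + 1)%:R * c1 - n.+1%:R * c0)).
have -> : (LegendreP rat n.+2)`_e = n.+2%:R^-1 *
    ((2 * n.+1 + 1)%:R * ('X * LegendreP rat n.+1)`_e - n.+1%:R * (LegendreP rat n)`_e).
  by rewrite -!coefZ -coefB -coefZ.
apply: reducesM => //.
  by apply: reducesV; rewrite ?natr_Fp_neq0 //; apply: reduces_nat.
apply: reducesD => //; last apply: reducesN => //; apply: reducesM => //; exact: reduces_nat.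
Qed.

(** * Power sums and quadratic residues in finite fields *)

Lemma finField_prim_root (F : finFieldType) :
  exists g : F, (#|F|.-1).-primitive_root g.
Proof.
have N_gt0 : (0 < #|F|.-1)%N by rewrite -ltnS prednK ?finNzRing_gt1 // ltnW ?finNzRing_gt1.
have /hasP[g _ g_prim] : has (#|F|.-1).-primitive_root (enum (predC1 (0 : F))).
  apply: has_prim_root; rewrite ?enum_uniq -?cardE ?cardC1 //.
  apply/allP => x; rewrite mem_enum => x0.
  apply/unity_rootP; apply: (mulfI x0).
  by rewrite mulr1 -exprS prednK ?expf_card // (leq_trans N_gt0) ?leq_pred.
by exists g.
Qed.

(** Multiplying the variable by a primitive root [g] shows that the sum is
    fixed by multiplication by [g^k], hence zero unless [g^k = 1]. The bound on
    [k] leaves [k = 0], where the sum is [#|F| = 0], and [k = #|F| - 1]. *)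
Lemma sum_expf (F : finFieldType) (k : nat) : (k < 2 * #|F|.-1)%N ->
  \sum_(x : F) x ^+ k = - (k == #|F|.-1)%:R.
Proof.
move=> k_lt; have [g g_prim] := finField_prim_root F.
have N_gt0 := prim_order_gt0 g_prim.
have F_gt0 : (0 < #|F|)%N by rewrite (leq_trans N_gt0) ?leq_pred.
have card0 : #|F|%:R = 0 :> F.
  have : \sum_(x : F) (x + 1) = \sum_(x : F) x.
    by rewrite [RHS](reindex_inj (addIr 1)).
  by rewrite big_split /= sumr_const => /(canRL (addKr _)); rewrite addNr.
have [->|k_neq] := eqVneq k #|F|.-1.
  rewrite (bigD1 0) //= expr0n gtn_eqF // add0r.
  rewrite (eq_bigr (fun=> 1)) => [|x x0].
    by apply/eqP; rewrite sumr_const cardC1 -addr_eq0 -mulrSr prednK // card0.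
  by apply: (mulfI x0); rewrite mulr1 -exprS prednK // expf_card.
rewrite oppr0; have [->|k_neq0] := eqVneq k 0%N.
  by under eq_bigr do rewrite expr0; rewrite sumr_const card0.
have g_neq0 : g != 0.
  apply/eqP => g0; have /eqP := prim_expr_order g_prim.
  by rewrite g0 expr0n gtn_eqF // eq_sym oner_eq0.
have : (g ^+ k - 1) * \sum_(x : F) x ^+ k = 0.
  rewrite mulrBl mul1r mulr_sumr [X in _ - X](reindex_inj (mulfI g_neq0)) /=.
  by rewrite -sumrB big1 // => x _; rewrite exprMn subrr.
move/eqP; rewrite mulf_eq0 subr_eq0 -(prim_order_dvd g_prim) => /orP[|/eqP //].
case/dvdnP=> [[|[|j]]] kE; exfalso; lia.
Qed.

(** If [c = g^i] with [g] primitive and [c^q = 1], then [2q] divides [iq], so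
    [i] is even and [c] is a square. *)
Lemma euler_criterion (F : finFieldType) (q : nat) (c : F) :
  #|F| = (2 * q).+1 -> c != 0 ->
  c ^+ q = if [exists y : F, y ^+ 2 == c] then 1 else -1.
Proof.
move=> cardF c_neq0; have [g] := finField_prim_root F.
rewrite cardF /= => g_prim.
have fermat (x : F) : x != 0 -> x ^+ (2 * q) = 1.
  by move=> x0; apply: (mulfI x0); rewrite mulr1 -exprS -cardF expf_card.
case: ifPn => [/existsP[y /eqP yE]|/existsPn nsq].
  rewrite -yE -exprM fermat //; apply: contraNneq c_neq0 => y0.
  by rewrite -yE y0 expr0n.
have /eqP : (c ^+ q) ^+ 2 = 1 by rewrite -exprM mulnC fermat.
rewrite sqrf_eq1 => /orP[|/eqP //].
have [i cE] := prim_rootP g_prim (fermat _ c_neq0).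
rewrite cE -exprM -(prim_order_dvd g_prim) dvdn_pmul2r; last by have := prim_order_gt0 g_prim; lia.
by case/dvdnP=> j iE; have := nsq (g ^+ j); rewrite cE iE exprM eqxx.
Qed.

(** * Expansion of the cubic power sum *)

(** The multinomial coefficient of [(x^3)^((q+e)/2) (mx)^((q-3e)/2) n^e] in
    [(x^3 + mx + n)^q]; these are the terms of degree [2q] in [x], and the value
    is 0 when one of the exponents is not a natural number. *)
Definition cubic_coef (q e : nat) : nat :=
  (if odd (q + e) then 0 else 'C(q, e) * 'C(q - e, (q + e)./2))%N.

Lemma sum_cubic_expf (F : finFieldType) (q : nat) (m n : F) :
  #|F| = (2 * q).+1 ->
  \sum_(x : F) (x ^+ 3 + m * x + n) ^+ q =
  - \sum_(e < q.+1)
      (cubic_coef q e)%:R * m ^+ (q - e - (q + e)./2) * n ^+ e.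
Proof.
move=> cardF.
have q_gt0 : (0 < q)%N by have := finNzRing_gt1 F; rewrite cardF; lia.
have expand (x : F) : (x ^+ 3 + m * x + n) ^+ q = \sum_(e < q.+1)
    \sum_(j < (q - e).+1) ('C(q, e) * 'C(q - e, j))%:R * m ^+ (q - e - j)
       * n ^+ e * x ^+ (q - e + 2 * j).
  have -> : x ^+ 3 + m * x = x * (m + x ^+ 2) by ring.
  rewrite exprDn; apply: eq_bigr => e _.
  rewrite exprMn [(m + _) ^+ _]exprDn mulr_sumr mulr_suml -sumrMnl.
  apply: eq_bigr => j _.
  by rewrite exprD exprM; ring.
under eq_bigr do rewrite expand.
rewrite exchange_big /= -sumrN; apply: eq_bigr => e _.
have e_le : (e <= q)%N by rewrite -ltnS.
rewrite exchange_big /=.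
transitivity (\sum_(j < (q - e).+1 | ~~ odd (q + e) && (j == (q + e)./2 :> nat))
   - (('C(q, e) * 'C(q - e, j))%:R * m ^+ (q - e - j) * n ^+ e)).
  rewrite [RHS]big_mkcond /=; apply: eq_bigr => j _; rewrite -mulr_sumr.
  have j_lt := ltn_ord j.
  rewrite sum_expf cardF /=; last by lia.
  have -> : (q - e + 2 * j == 2 * q)%N = ~~ odd (q + e) && (j == (q + e)./2 :> nat) by lia.
  by case: ifP => _; rewrite ?mulrN ?mulr1 // mulr0 oppr0.
rewrite /cubic_coef; case: ifP => odd_qe; first by rewrite big_pred0_eq !mul0r oppr0.
rewrite (big_ord1_eq _ (fun j => - (('C(q, e) * 'C(q - e, j))%:R * m ^+ (q - e - j) * n ^+ e))).
by case: ltnP => // lt; rewrite ['C(q - e, _)]bin_small // muln0 !mul0r oppr0.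
Qed.

(** The cubic is [(x-1)^2 (x+2)]: outside its node [x = 1] its [q]-th power is
    that of [x + 2], and the sum of all [q]-th powers vanishes. *)
Lemma sum_cubic_node (F : finFieldType) (q : nat) :
  (1 < q)%N -> #|F| = (2 * q).+1 ->
  \sum_(x : F) (x ^+ 3 + (-3) * x + 2) ^+ q = - 3 ^+ q.
Proof.
move=> q_gt1 cardF.
have -> : \sum_(x : F) (x ^+ 3 + (-3) * x + 2) ^+ q =
   \sum_(x : F) (x + 2) ^+ q - 3 ^+ q.
  rewrite (bigD1 1) //= [in RHS](bigD1 1) //=.
  have -> : 1 ^+ 3 + (-3) * 1 + 2 = 0 :> F by ring.
  have -> : 1 + 2 = 3 :> F by ring.
  rewrite expr0n gtn_eqF ?(ltnW q_gt1) // add0r [RHS]addrAC subrr add0r.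
  apply: eq_bigr => x x1.
  have -> : x ^+ 3 + (-3) * x + 2 = (x - 1) ^+ 2 * (x + 2) by ring.
  have x1' : x - 1 != 0 by rewrite subr_eq0.
  rewrite exprMn -exprM -[RHS]mul1r; congr (_ * _).
  by apply: (mulfI x1'); rewrite mulr1 -exprS -cardF expf_card.
have -> : \sum_(x : F) (x + 2) ^+ q = \sum_(x : F) x ^+ q.
  by rewrite [RHS](reindex_inj (addIr 2)).
rewrite sum_expf cardF /=; last by lia.
have -> : (q == 2 * q)%N = false by lia.
by rewrite oppr0 add0r.
Qed.

Lemma cubic_coef_eq0 (q e : nat) : (q < 3 * e)%N -> cubic_coef q e = 0%N.
Proof.
move=> lt; rewrite /cubic_coef; case: ifP => // even_qe.
by rewrite ['C(q - e, _)]bin_small ?muln0 //; lia.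
Qed.

(** The exponent [k] is [(q-3e)/2]; passing from [e] to [e+2] replaces [k] by
    [k-3] and [(q+e)/2] by its successor. With truncated subtraction the
    identity includes the case [k < 3], where both sides vanish. *)
Lemma cubic_coef_rec (q e : nat) : (e + 2 <= q)%N -> ~~ odd (q + e) ->
  let k := (q - e - (q + e)./2)%N in
  (cubic_coef q e.+2 * (e.+1 * e.+2 * (q + e)./2.+1) =
   cubic_coef q e * (k * k.-1 * k.-2))%N.
Proof.
move=> e_le even_qe k; rewrite /cubic_coef !addnS /= negbK (negPf even_qe).
set j := (q + e)./2; set M := (q - e)%N.
have M_gt1 : (1 < M)%N by rewrite /M; lia.
have -> : (q - e.+2 = M.-2)%N by rewrite /M; lia.
have B1 := mul_bin_left q e; have B2 := mul_bin_left q e.+1.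
have B3 := mul_bin_left M.-2 j.
have B4 := mul_bin_down M.-1 j; have B5 := mul_bin_down M j.
have kE : k = (M - j)%N by [].
have k1E : k.-1 = (M.-1 - j)%N by lia.
have k2E : k.-2 = (M.-2 - j)%N by lia.
rewrite k2E k1E kE.
set c := 'C(q, e) in B1 *; set c1 := 'C(q, e.+1) in B1 B2; set c2 := 'C(q, e.+2) in B2 *.
set d0 := 'C(M, j) in B5 *; set d1 := 'C(M.-1, j) in B4 B5.
set d2 := 'C(M.-2, j) in B3 B4; set d3 := 'C(M.-2, j.+1) in B3 *.
transitivity ((e.+2 * c2) * e.+1 * (j.+1 * d3))%N; first by ring.
rewrite B2 B3.
transitivity ((q - e.+1) * (e.+1 * c1) * ((M.-2 - j) * d2))%N; first by ring.
rewrite B1.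
transitivity (c * (M.-2 - j) * (M * (M.-1 * d2)))%N.
  by rewrite subnS -/M; ring.
rewrite B4.
transitivity (c * (M.-2 - j) * (M.-1 - j) * (M * d1))%N; first by ring.
rewrite B5; ring.
Qed.

(** * Comparison with the Legendre polynomial *)

(** Modulo [p] one has [2q = -1], so that [4k = -(6e+1)] for the [k] of
    [cubic_coef_rec] and [4((q+e)/2 + 1) = 2e+3]. The product
    [64 k(k-1)(k-2) = -(6e+1)(6e+5)(6e+9)] thus contains the factor [2e+3],
    which cancels. *)
Lemma cubic_coef_recF (p q e : nat) : prime p -> (3 < p)%N -> p = (2 * q).+1 ->
  (e + 2 <= q)%N ->
  let u i : 'F_p := (cubic_coef q i)%:R * (-3) ^+ (q - i - (q + i)./2) * 2 ^+ i in
  (36 * (e.+1 * e.+2))%:R * u e.+2 = ((6 * e + 1) * (6 * e + 5))%:R * u e.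
Proof.
move=> p_prime p_gt3 pE e_le u.
have [odd_qe|even_qe] := boolP (odd (q + e)).
  by rewrite /u /cubic_coef !addnS /= negbK odd_qe !mul0r !mulr0.
have [q_lt|q_ge] := ltnP q (3 * e).
  by rewrite /u !cubic_coef_eq0 ?mul0r ?mulr0 //; lia.
have := cubic_coef_rec e_le even_qe.
have uS : u e.+2 * (-27) =
    4 * (cubic_coef q e.+2)%:R * ((-3) ^+ (q - e - (q + e)./2) * 2 ^+ e).
  (* Truncation makes the exponent of -3 wrong for [k < 3], but then the
     coefficient is zero. *)
  have [k_lt|k_ge] := ltnP (q - e - (q + e)./2) 3.
    by rewrite /u cubic_coef_eq0 ?mul0r ?mulr0 ?mul0r //; lia.
  rewrite /u; have -> : (q - e.+2 - (q + e.+2)./2 = q - e - (q + e)./2 - 3)%N by lia.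
  rewrite -[in RHS](subnK k_ge) exprD !exprS; ring.
move: uS; rewrite [u e]/u; set w := _ ^+ _ * _; set k := (q - e - _)%N => uS.
set j := (q + e)./2 => rec.
have p0 : p%:R = 0 :> 'F_p by rewrite pchar_Fp_0.
have recF : (cubic_coef q e.+2)%:R * ((e%:R + 1) * (e%:R + 2) * j.+1%:R) =
   (cubic_coef q e)%:R * (k%:R * (k%:R - 1) * (k%:R - 2)) :> 'F_p.
  have -> : k%:R * (k%:R - 1) * (k%:R - 2) = (k * k.-1 * k.-2)%:R :> 'F_p.
    by case: (k) => [|[|k']] /=; rewrite ?muln0 ?mul0n ?natrM; ring.
  rewrite -[RHS]natrM -rec; ring.
have k4 : 4 * k%:R = - (6 * e%:R + 1) :> 'F_p.
  have -> : - (6 * e%:R + 1) = p%:R - 6 * e%:R - 1 :> 'F_p by rewrite p0; ring.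
  have -> : p = (4 * k + 6 * e + 1)%N by rewrite /k; lia.
  ring.
have j4 : 4 * j.+1%:R = 2 * e%:R + 3 :> 'F_p.
  have -> : 2 * e%:R + 3 = p%:R + 2 * e%:R + 3 :> 'F_p by rewrite p0; ring.
  have -> : p = (4 * j.+1 - 2 * e - 3)%N by rewrite /j; lia.
  rewrite -[in RHS]addrA -!natrM -!natrD; congr _%:R; rewrite /j; lia.
have two_neq0 : 2 != 0 :> 'F_p by apply: natr_Fp_neq0 => //; lia.
have three_neq0 : 3 != 0 :> 'F_p by apply: natr_Fp_neq0 => //; lia.
have j_neq0 : j.+1%:R != 0 :> 'F_p by apply: natr_Fp_neq0 => //; rewrite /j; lia.
(* Clears the denominators: -27 comes from [uS], 64 from [k4] and [j4]. *)
have c_neq0 : (-27) * 2 ^+ 6 * j.+1%:R != 0 :> 'F_p.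
  have -> : -27 = - 3 ^+ 3 :> 'F_p by ring.
  by rewrite !mulf_neq0 ?oppr_eq0 ?expf_neq0.
apply: (mulfI c_neq0).
transitivity (36 * 4 * 64 * w * ((cubic_coef q e.+2)%:R * ((e%:R + 1) * (e%:R + 2) * j.+1%:R)) : 'F_p).
  transitivity (36 * 64 * (e%:R + 1) * (e%:R + 2) * j.+1%:R * (u e.+2 * (-27)) : 'F_p); first by ring.
  rewrite uS; ring.
rewrite recF.
transitivity (144 * w * (cubic_coef q e)%:R * (4 * k%:R * (4 * k%:R - 4) * (4 * k%:R - 8)) : 'F_p).
  by ring.
rewrite k4.
transitivity (-432 * w * (cubic_coef q e)%:R * (6 * e%:R + 1) * (6 * e%:R + 5) * (4 * j.+1%:R) : 'F_p).
  by rewrite j4; ring.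
rewrite /w; ring.
Qed.

(** The factor [36 (e+1)(e+2)] is invertible modulo [p] for [e + 2 <= q], so
    the recurrence propagates a zero from the least index of the parity class
    of [q], which is [odd q] read as 0 or 1. *)
Lemma parity_rec_eq0 (p q : nat) (u : nat -> 'F_p) :
  prime p -> (3 < p)%N -> p = (2 * q).+1 ->
  (forall e, odd (q + e) -> u e = 0) ->
  (forall e, (e + 2 <= q)%N ->
     (36 * (e.+1 * e.+2))%:R * u e.+2 = ((6 * e + 1) * (6 * e + 5))%:R * u e) ->
  u (odd q) = 0 -> forall e, (e <= q)%N -> u e = 0.
Proof.
move=> p_prime p_gt3 pE u_par u_rec u0.
suff H e : ((e <= q)%N -> u e = 0) /\ ((e.+1 <= q)%N -> u e.+1 = 0) by move=> e; case: (H e).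
elim: e => [|e [IH0 IH1]].
  have u_small i : (i <= 1)%N -> u i = 0.
    by move=> i_le; have [/u_par //|par] := boolP (odd (q + i)); rewrite -u0; congr u; lia.
  by split=> _; apply: u_small.
split=> // e_le; have e_le2 : (e + 2 <= q)%N by lia.
have := u_rec e e_le2; rewrite IH0 ?mulr0; last by lia.
move/eqP; rewrite mulf_eq0 => /orP[|/eqP //].
rewrite -(dvdn_pcharf (pchar_Fp p_prime)) (_ : 36 = 2 * 2 * (3 * 3))%N //.
by rewrite !Euclid_dvdM // !gtnNdvd //; lia.
Qed.

(** By [parity_rec_eq0] the solutions on one parity class form a line, on which
    the sum of the terms is a coordinate. *)
Lemma parity_rec_unique (p q : nat) (c : 'F_p) (u v : nat -> 'F_p) :
  prime p -> (3 < p)%N -> p = (2 * q).+1 ->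
  (forall e, odd (q + e) -> u e = 0) -> (forall e, odd (q + e) -> v e = 0) ->
  (forall e, (e + 2 <= q)%N ->
     (36 * (e.+1 * e.+2))%:R * u e.+2 = ((6 * e + 1) * (6 * e + 5))%:R * u e) ->
  (forall e, (e + 2 <= q)%N ->
     (36 * (e.+1 * e.+2))%:R * v e.+2 = ((6 * e + 1) * (6 * e + 5))%:R * v e) ->
  \sum_(i < q.+1) u i = c -> \sum_(i < q.+1) v i = 1 ->
  forall e, (e <= q)%N -> u e = c * v e.
Proof.
move=> p_prime p_gt3 pE u_par v_par u_rec v_rec u_sum v_sum e e_le.
have v_neq0 : v (odd q) != 0.
  apply/eqP => v0; have v_eq0 := parity_rec_eq0 p_prime p_gt3 pE v_par v_rec v0.
  have sum0 : \sum_(i < q.+1) v i = 0 by apply: big1 => i _; apply: v_eq0; rewrite -ltnS.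
  by move: (oner_neq0 'F_p); rewrite -v_sum sum0 eqxx.
(* A combination of [u] and [v] that vanishes at the first index. *)
have prop i : (i <= q)%N -> v (odd q) * u i = u (odd q) * v i.
  move=> i_le; apply/eqP; rewrite -subr_eq0; apply/eqP.
  apply: (@parity_rec_eq0 p q (fun i => v (odd q) * u i - u (odd q) * v i)
    p_prime p_gt3 pE _ _ _ i i_le) => [j odd_qj|j j_le|].
  - by rewrite /= (u_par j) // (v_par j) // !mulr0 subr0.
  - by rewrite /= !mulrBr !(mulrCA _%:R) (u_rec j) // (v_rec j).
  - by rewrite mulrC subrr.
have u0 : u (odd q) = v (odd q) * c.
  rewrite -u_sum mulr_sumr -[LHS]mulr1 -v_sum mulr_sumr.
  by apply: eq_bigr => i _; rewrite prop // -ltnS.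
by apply: (mulfI v_neq0); rewrite prop // u0 mulrA.
Qed.

Lemma prime_gt3_mod6 (p : nat) : prime p -> (3 < p)%N ->
  (p %% 6 = 1 \/ p %% 6 = 5)%N.
Proof.
move=> p_prime p_gt3.
have p_ndvd d : (1 < d <= 3)%N -> (p %% d != 0)%N.
  case/andP=> d_gt1 d_le; apply/negP => /(prime_nt_dvdP p_prime) dE.
  by have : d = p := dE ltac:(lia); lia.
by have := p_ndvd 2 isT; have := p_ndvd 3 isT; lia.
Qed.

(** Both sequences satisfy the recurrence of [parity_rec_unique]; the sum over
    [e], which is the value at [t = 1] of the corresponding polynomial, fixes
    the factor [3^q]. *)
Lemma cubic_coef_LegendreP (p q e : nat) : prime p -> (3 < p)%N ->
  p = (2 * q).+1 -> (e <= q)%N ->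
  (cubic_coef q e)%:R * (-3) ^+ (q - e - (q + e)./2) * 2 ^+ e =
  3 ^+ q * ratr (LegendreP rat (p %/ 6))`_e :> 'F_p.
Proof.
move=> p_prime p_gt3 pE e_le; set N := (p %/ 6)%N.
pose a i : 'F_p := (cubic_coef q i)%:R * (-3) ^+ (q - i - (q + i)./2) * 2 ^+ i.
pose b i : 'F_p := ratr (LegendreP rat N)`_i.
have p6 := prime_gt3_mod6 p_prime p_gt3.
have N6 : (p = 6 * N + 1 \/ p = 6 * N + 5)%N by rewrite /N; lia.
have N_lt : (N < p)%N by lia.
have N_le : (N <= q)%N by lia.
have redb i : reduces (LegendreP rat N)`_i (b i).
  by apply: reduces_Rp; apply: LegendreP_coef_Rp.
have a_par i : odd (q + i) -> a i = 0.
  by move=> odd_qi; rewrite /a /cubic_coef odd_qi !mul0r.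
have b_par i : odd (q + i) -> b i = 0.
  by move=> odd_qi; rewrite /b LegendreP_parity ?(ratr_nat _ 0) //; lia.
have a_rec i : (i + 2 <= q)%N ->
    (36 * (i.+1 * i.+2))%:R * a i.+2 = ((6 * i + 1) * (6 * i + 5))%:R * a i.
  by move=> i_le; apply: cubic_coef_recF.
have b_rec i : (i + 2 <= q)%N ->
    (36 * (i.+1 * i.+2))%:R * b i.+2 = ((6 * i + 1) * (6 * i + 5))%:R * b i.
  move=> _; have N5 : ((6 * N + 1) * (6 * N + 5))%:R = 0 :> 'F_p.
    have p0 : p%:R = 0 :> 'F_p by rewrite pchar_Fp_0.
    by rewrite natrM; case: N6 => <-; rewrite p0 ?mul0r ?mulr0.
  have rec : (i.+1 * i.+2)%:R * b i.+2 =
      ((i * i.+1)%:R - (N * N.+1)%:R) * b i.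
    apply: (@reduces_inj p ((i.+1 * i.+2)%:R * (LegendreP rat N)`_i.+2)).
      by apply: reducesM => //; apply: reduces_nat.
    rewrite LegendreP_coef_rec; apply: reducesM => //; apply: reducesD => //.
      exact: reduces_nat.
    by apply: reducesN => //; apply: reduces_nat.
  rewrite natrM -mulrA rec mulrA; congr (_ * _).
  transitivity (((6 * i + 1) * (6 * i + 5))%:R - ((6 * N + 1) * (6 * N + 5))%:R : 'F_p); first by ring.
  by rewrite N5 subr0.
have a_sum : \sum_(i < q.+1) a i = 3 ^+ q.
  apply: oppr_inj; rewrite -(@sum_cubic_node 'F_p q) ?card_Fp //; last by lia.
  by rewrite (@sum_cubic_expf _ q) ?card_Fp.
have b_sum : \sum_(i < q.+1) b i = 1.
  apply: (@reduces_inj p (\sum_(i < q.+1) (LegendreP rat N)`_i)).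
    exact: reduces_sum.
  have -> : \sum_(i < q.+1) (LegendreP rat N)`_i = 1.
    rewrite -(LegendreP_at1 rat N) (sum_LegendreP_coefs _ N_le).
    by apply: eq_bigr => i _; rewrite expr1n mulr1.
  exact: (reduces_nat 1).
exact: (parity_rec_unique (u := a) (v := b) p_prime p_gt3 pE a_par b_par a_rec b_rec a_sum b_sum e_le).
Qed.

Lemma legendre_symbol_Fp (p q : nat) (a : rat) (c : 'F_p) : prime p ->
  p = (2 * q).+1 -> reduces a c -> (legendre_symbol p a)%:~R = c ^+ q.
Proof.
move=> p_prime pE [_ <-]; rewrite /legendre_symbol.
have p_gt1 := prime_gt1 p_prime.
have [->|c_neq0] := eqVneq; first by rewrite expr0n gtn_eqF //; lia.
by rewrite (@euler_criterion _ q) ?card_Fp //; case: ifP.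
Qed.

Lemma legendre_sum_Fp (p q : nat) (m n : rat) : prime p -> p = (2 * q).+1 ->
  m \in Rp p -> n \in Rp p ->
  (\sum_(0 <= x < p) legendre_symbol p (x%:R ^+ 3 + m * x%:R + n))%:~R =
  \sum_(x : 'F_p) (x ^+ 3 + ratr m * x + ratr n) ^+ q.
Proof.
move=> p_prime pE mRp nRp; rewrite rmorph_sum /= -[in index_iota _ _](Fp_cast p_prime).
rewrite big_mkord; apply: eq_bigr => x _.
apply: legendre_symbol_Fp => //.
have redx : reduces x%:R (x : 'F_p).
  by rewrite -[X in reduces _ X]natr_Zp; apply: reduces_nat.
apply: reducesD => //; apply: reducesD => //; first exact: reducesX.
exact: reducesM.
Qed.

(** The value [- s^q P_N(3ns / 2m^2)] for any [s] with [s^2 = -3m], written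
    without [s]: the terms of [P_N] have the parity of [q], so they contribute
    even powers [s^(q+e)]. This is the element of [R_p] that witnesses the
    congruence. *)
Definition legendre_value (m n : rat) (N q : nat) : rat :=
  - \sum_(e < q.+1) (LegendreP rat N)`_e * (3 * n / (2 * m ^+ 2)) ^+ e
       * (-3 * m) ^+ (q + e)./2.

Lemma ratr_legendre_value (F : numFieldType) (m n : rat) (s : F) (N q : nat) :
  s ^+ 2 = ratr (- 3 * m) -> (N <= q)%N -> odd N = odd q ->
  ratr (legendre_value m n N q) =
   - (s ^+ q * (LegendreP F N).[3 * ratr n * s / (2 * ratr m ^+ 2)]).
Proof.
move=> sE N_le oddN.
rewrite /legendre_value.
have -> : 3 * ratr n * s / (2 * ratr m ^+ 2) = ratr (3 * n / (2 * m ^+ 2)) * s.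
  by rewrite fmorph_div !expr2 !rmorphM /= !ratr_nat mulrAC.
move: (3 * n / _) => x.
rewrite (sum_LegendreP_coefs _ N_le) rmorphN rmorph_sum mulr_sumr; congr (- _).
apply: eq_bigr => e _; rewrite -(map_LegendreP F) coef_map !rmorphM /=.
have [odd_qe|even_qe] := boolP (odd (q + e)).
  by rewrite LegendreP_parity ?rmorph0 ?mul0r ?mulr0 // oddD oddN -oddD.
rewrite !rmorphXn /= -sE -exprM.
have -> : (2 * (q + e)./2 = q + e)%N by lia.
rewrite exprD [(ratr x * s) ^+ e]exprMn; ring.
Qed.

(** The change of variables from the family [m = -3], [n = 2t] to arbitrary
    [m], [n], on the terms of degree [e] in [n]. With [q = 2k + 3e] and
    [(q+e)/2 = k + 2e] every power is a product of [k]-th and [e]-th powers, and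
    the signs of -3 occur to even powers. *)
Lemma cubic_term_legendre (F : fieldType) (q k e : nat) (a b m n : F) :
  2 != 0 :> F -> 3 != 0 :> F -> m != 0 -> q = (2 * k + 3 * e)%N ->
  a * (-3) ^+ k * 2 ^+ e = 3 ^+ q * b ->
  a * m ^+ k * n ^+ e =
    b * (3 * n / (2 * m ^+ 2)) ^+ e * (- 3 * m) ^+ (k + 2 * e).
Proof.
move=> two_neq0 three_neq0 m_neq0 qE abE.
have E1 : (3 * n / (2 * m ^+ 2)) ^+ e = 3 ^+ e * n ^+ e / (2 ^+ e * (m ^+ e) ^+ 2).
  by rewrite expr_div_n !exprMn -expr2.
have E2 : (- 3 * m) ^+ (k + 2 * e) =
    (-3) ^+ k * (3 ^+ e) ^+ 2 * m ^+ k * (m ^+ e) ^+ 2.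
  by rewrite exprD !exprMn ![_ ^+ (2 * e)]exprM sqrrN !(exprAC _ 2 e); ring.
have E3 : 3 ^+ q = ((-3) ^+ k) ^+ 2 * (3 ^+ e) ^+ 3 :> F.
  by rewrite (exprAC _ k 2) sqrrN -!exprM -exprD [(e * 3)%N]mulnC -qE.
apply: (mulfI (expf_neq0 q three_neq0)).
rewrite E1 E2 -[b * _ * _]mulrA [RHS]mulrA -abE E3.
have := expf_neq0 e two_neq0; have := expf_neq0 e m_neq0.
by move=> m_e two_e; field; rewrite m_e two_e.
Qed.

(** Term by term, [cubic_coef_LegendreP] matches the expansion
    [sum_cubic_expf]. *)
Lemma reduces_legendre_value (p q : nat) (m n : rat) : prime p -> (3 < p)%N ->
  p = (2 * q).+1 -> m \in Rp p -> n \in Rp p -> ratr m != 0 :> 'F_p ->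
  reduces (legendre_value m n (p %/ 6) q)
    (\sum_(x : 'F_p) (x ^+ 3 + ratr m * x + ratr n) ^+ q).
Proof.
move=> p_prime p_gt3 pE mRp nRp; set M : 'F_p := ratr m; set V : 'F_p := ratr n.
move=> M_neq0; rewrite (@sum_cubic_expf _ q) ?card_Fp //; apply: reducesN => //.
have two_neq0 : 2 != 0 :> 'F_p by apply: natr_Fp_neq0 => //; lia.
have three_neq0 : 3 != 0 :> 'F_p by apply: natr_Fp_neq0 => //; lia.
apply: reduces_sum => // e _.
have e_le : (e <= q)%N by rewrite -ltnS.
have Pe := cubic_coef_LegendreP p_prime p_gt3 pE e_le.
set b : 'F_p := ratr _ in Pe.
have -> : (cubic_coef q e)%:R * M ^+ (q - e - (q + e)./2) * V ^+ e =
   b * (3 * V / (2 * M ^+ 2)) ^+ e * (- 3 * M) ^+ (q + e)./2.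
  have [A0|A_neq0] := eqVneq (cubic_coef q e) 0%N.
    move: Pe; rewrite A0 !mul0r => /esym/eqP.
    by rewrite mulf_eq0 expf_eq0 (negPf three_neq0) andbF => /eqP ->; rewrite !mul0r.
  have even_qe : ~~ odd (q + e).
    by apply: contraNN A_neq0 => odd_qe; rewrite /cubic_coef odd_qe.
  have e3_le : (3 * e <= q)%N.
    by rewrite leqNgt; apply: contraNN A_neq0 => /cubic_coef_eq0 ->.
  set k := (q - e - (q + e)./2)%N in Pe *.
  have -> : ((q + e)./2 = k + 2 * e)%N by rewrite /k; lia.
  have qE : q = (2 * k + 3 * e)%N by rewrite /k; lia.
  exact: (cubic_term_legendre V two_neq0 three_neq0 M_neq0 qE Pe).
apply: reducesM => //; first apply: reducesM => //.
- by apply: reduces_Rp; apply: LegendreP_coef_Rp => //; rewrite ltn_Pdiv; lia.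
- apply: reducesX => //; apply: reducesM => //.
    by apply: reducesM => //; apply: (reduces_nat 3).
  apply: reducesV => //; first by rewrite mulf_neq0 // expf_neq0.
  by apply: reducesM => //; [apply: (reduces_nat 2)|apply: reducesX].
apply: reducesX => //; apply: reducesM => //; apply: reducesN => //.
exact: (reduces_nat 3).
Qed.

Theorem theorem2p1 (p : nat) (m n : rat) (s : algC)
  (p_prime : prime p) (p_gt3 : (3 < p)%N)
  (mRp : m \in Rp p) (nRp : n \in Rp p) (m_neq0 : ~~ eqRp p m 0)
  (s_sqrt : s ^+ 2 = ratr (- 3%:R * m)) :
  let S : int :=
    \sum_(0 <= x < p) legendre_symbol p (x%:R ^+ 3 + m * x%:R + n) in
  let P : algC :=
    (LegendreP algC (p %/ 6)).[3%:R * ratr n * s / (2%:R * ratr m ^+ 2)] in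
  (p = 1 %[mod 4] ->
     eqRpC p S%:~R (- ratr (- 3%:R * m) ^+ ((p - 1) %/ 4) * P)) /\
  (p = 3 %[mod 4] ->
     eqRpC p S%:~R (- (ratr (- 3%:R * m) ^+ ((p + 1) %/ 4) / s) * P)).
Proof.
move=> S P; set q := (p %/ 2)%N.
have p6 := prime_gt3_mod6 p_prime p_gt3.
have pE : p = (2 * q).+1 by rewrite /q; lia.
have M_neq0 : ratr m != 0 :> 'F_p by apply: contraNneq m_neq0; apply: eqRp0.
have s_neq0 : s != 0.
  apply: contraNneq M_neq0 => s0; move/eqP: s_sqrt.
  rewrite s0 expr0n eq_sym fmorph_eq0 mulf_eq0 oppr_eq0 pnatr_eq0 /= => /eqP ->.
  by rewrite (ratr_nat _ 0).
have [wRp w_red] := reduces_legendre_value p_prime p_gt3 pE mRp nRp M_neq0.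
have cong : eqRpC p S%:~R (- (s ^+ q * P)).
  exists (legendre_value m n (p %/ 6) q); split=> //.
    by rewrite (ratr_legendre_value _ s_sqrt) //; lia.
  apply: (reduces_eqRp p_prime _ (conj wRp w_red)).
  by rewrite -legendre_sum_Fp //; apply: reduces_int.
split=> p4.
  have -> : - ratr (- 3%:R * m) ^+ ((p - 1) %/ 4) * P = - (s ^+ q * P) => //.
  by rewrite -s_sqrt -exprM mulNr; congr (- (s ^+ _ * _)); lia.
have -> : - (ratr (- 3%:R * m) ^+ ((p + 1) %/ 4) / s) * P = - (s ^+ q * P) => //.
rewrite -s_sqrt -exprM mulNr; congr (- (_ * _)); apply: (mulIf s_neq0).
by rewrite divfK // -exprSr; congr (s ^+ _); lia.
Qed.
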